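(* Let $K$ be a compact set in $\mathbb R^3$. A point $p\in\mathbb R^3$ belongs to the minimal hull $\widehat K_{\mathfrak M}$ of $K$ if and only if there exists a probability measure $\nu$ on $K$ such that $$u(p)\le\int_K u\,d\nu\le\max_K u\qquad\forall u\in\mathfrak M\mathrm{Psh}(\mathbb R^3).$$
   Context: Subharmonic functions are allowed to be identically $-\infty$. An upper semicontinuous function $u\colon\omega\to\mathbb R\cup\{-\infty\}$ on a domain $\omega\subset\mathbb R^n$ ($n\ge3$) is minimal plurisubharmonic if its restriction to any affine $2$-dimensional plane $L\subset\mathbb R^n$ is subharmonic on $L\cap\omega$ in any isothermal linear coordinates on $L$ (coordinates $(y_1,y_2)$ given by $x=a+y_1v_1+y_2v_2$ with $a\in L$ and $v_1,v_2$ orthogonal of equal nonzero length); the set of such functions is $\mathfrak M\mathrm{Psh}(\omega)$. The minimal hull of a compact set $K\subset\mathbb R^n$ is $\widehat K_{\mathfrak M}=\{x\in\mathbb R^n: u(x)\le\sup_K u\ \ \forall u\in\mathfrak M\mathrm{Psh}(\mathbb R^n)\}$. *)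

(* Defs.v *)
From HB Require Import structures.
From mathcomp Require Export all_boot all_order all_algebra.
From mathcomp Require Export all_classical all_reals all_analysis.

Set Implicit Arguments.
Unset Strict Implicit.
Unset Printing Implicit Defensive.

Export Order.TTheory GRing.Theory Num.Theory.
Export numFieldNormedType.Exports.

Local Open Scope classical_set_scope.
Local Open Scope ring_scope.

(* Functions on a subset D of a space are total functions of which only the
   values on D matter. *)
Definition usc_on (R : realType) (T : topologicalType) (D : set T)
    (u : T -> \bar R) : Prop :=
  forall x, D x -> forall a : R, (u x < a%:E)%E ->
    \forall y \near within D (nbhs x), (u y < a%:E)%E.

Definition circle_pt (R : realType) (c : R * R) (r t : R) : R * R :=
  (c.1 + r * cos t, c.2 + r * sin t).

Definition closed_disc (R : realType) (c : R * R) (r : R) : set (R * R) :=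
  [set y | (y.1 - c.1) ^+ 2 + (y.2 - c.2) ^+ 2 <= r ^+ 2].

(* Subharmonicity on an open subset D of the plane, by the submean inequality
   over circles. The function that is identically -oo is allowed. The integral
   may be -oo; it is well defined because u is bounded above on circles. *)
Definition subharmonic (R : realType) (D : set (R * R))
    (u : R * R -> \bar R) : Prop :=
  [/\ forall y, D y -> (u y < +oo)%E,
      usc_on D u &
      forall (c : R * R) (r : R), 0 < r -> closed_disc c r `<=` D ->
        (u c <= ((2 * pi)^-1)%:E *
          \int[lebesgue_measure]_(t in `[0%R, (2 * pi)%R]) u (circle_pt c r t))%E].

Definition dot (R : realType) (n : nat) (v w : 'rV[R]_n) : R :=
  \sum_(i < n) v ord0 i * w ord0 i.

Definition plane_param (R : realType) (n : nat) (a v1 v2 : 'rV[R]_n)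
    (y : R * R) : 'rV[R]_n :=
  a + y.1 *: v1 + y.2 *: v2.

(* Two-dimensional affine planes in R^n are quantified together with their
   isothermal linear coordinates: base point a and orthogonal vectors v1, v2 of
   equal nonzero length. *)
Definition MPsh (R : realType) (n : nat) (omega : set 'rV[R]_n)
    (u : 'rV[R]_n -> \bar R) : Prop :=
  [/\ forall x, omega x -> (u x < +oo)%E,
      usc_on omega u &
      forall a v1 v2 : 'rV[R]_n,
        dot v1 v2 = 0 -> dot v1 v1 = dot v2 v2 -> v1 != 0 ->
        subharmonic (plane_param a v1 v2 @^-1` omega)
                    (u \o plane_param a v1 v2)].

Definition sup_on (R : realType) (T : Type) (K : set T) (u : T -> \bar R) :
  \bar R := ereal_sup (u @` K).

Definition minimal_hull (R : realType) (n : nat) (K : set 'rV[R]_n) :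
    set 'rV[R]_n :=
  [set x | forall u, MPsh setT u -> (u x <= sup_on K u)%E].

(* Main.v *)
From HB Require Import structures.
Require Import Defs.
From mathcomp Require Import measurable_realfun ring lra.

Set Implicit Arguments.
Unset Strict Implicit.
Unset Printing Implicit Defensive.

Local Open Scope classical_set_scope.
Local Open Scope ring_scope.

(** The measure comes from Edwards' duality theorem, which only uses that the
    minimal plurisubharmonic functions form a convex cone of upper
    semicontinuous functions containing the constants.  If [p] is in the hull,
    [f |-> inf {- u p | u <= - f on K}] is a finite sublinear functional on
    bounded functions, and Hahn-Banach gives a positive normalized linear [l]
    below it; thus [u p <= l f] whenever [u <= f] on [K].

    On indicators, [l] is a finitely additive probability [m] concentrated on
    [K].  Regularizing [m] from inside on open sets and then from outside gives
    a Borel probability [nu] with [nu O <= m O] for all open [O].  Slicing a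
    bounded lower semicontinuous [f >= 0] along its open superlevel sets yields
    [\int f dnu <= l f].  For an upper semicontinuous [u <= M] on [K] this
    applies to the truncations of [M - u] at [N], and monotone convergence in
    [N] gives [u p <= \int u dnu]. *)

(** * Hahn-Banach by minimal sublinear functionals *)

Section HahnBanach.
Context {R : realType} {V : lmodType R}.

(** A predicate on the ambient module rather than a subtype, so that bounded functions can be
    handled inside the module of all functions. *)
Definition subspace (P : set V) : Prop :=
  (forall x y, P x -> P y -> P (x + y)) /\ (forall k x, P x -> P (k *: x)).

Definition sublinear_on (P : set V) (q : V -> R) : Prop :=
  (forall x y, P x -> P y -> q (x + y) <= q x + q y) /\
  (forall k x, 0 <= k -> P x -> q (k *: x) <= k * q x).

Definition linear_on (P : set V) (l : V -> R) : Prop :=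
  (forall x y, P x -> P y -> l (x + y) = l x + l y) /\
  (forall k x, P x -> l (k *: x) = k * l x).

Context (P : set V) (hP : subspace P).

Lemma subspaceN x : P x -> P (- x).
Proof. by rewrite -scaleN1r; exact: hP.2. Qed.

(** Scaling back by [k^-1] turns the assumed inequality into an equality; at [k = 0], subadditivity
    gives [0 <= q 0]. *)
Lemma sublinear_onZ q k x : sublinear_on P q -> 0 <= k -> P x ->
  q (k *: x) = k * q x.
Proof.
move=> [qD qZ] k0 Px; apply/eqP; rewrite eq_le qZ//=.
move: k0; rewrite (le_eqVlt 0 k) => /orP[/eqP<-|k0].
  have P0 : P 0 by rewrite -(scale0r x); exact: hP.2.
  by rewrite mul0r scale0r; have := qD _ _ P0 P0; rewrite addr0; lra.
rewrite mulrC -ler_pdivlMr// mulrC.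
have := qZ k^-1 (k *: x) (ltW _) (hP.2 _ _ Px).
rewrite scalerA mulVf ?gt_eqF// scale1r; apply.
by rewrite invr_gt0.
Qed.

Lemma sublinear_onN q x : sublinear_on P q -> P x -> - q (- x) <= q x.
Proof.
move=> qs Px; have := qs.1 _ _ Px (subspaceN Px).
have : q (0 *: x) = 0 by rewrite (sublinear_onZ qs)// mul0r.
by rewrite scale0r subrr => ->; lra.
Qed.

(** Comparability makes the pointwise infimum subadditive: of two members chosen at [x] and at [y],
    the smaller one serves at both points. The bound [- q (- x)] keeps the infimum finite. *)
Lemma sublinear_inf_chain q (A : set (V -> R)) :
  A !=set0 -> (forall s, A s -> sublinear_on P s) ->
  (forall s x, A s -> P x -> s x <= q x) ->
  (forall s t, A s -> A t ->
     (forall x, P x -> s x <= t x) \/ (forall x, P x -> t x <= s x)) ->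
  exists t, [/\ sublinear_on P t, forall x, P x -> t x <= q x &
    forall s x, A s -> P x -> t x <= s x].
Proof.
move=> [s0 As0] Asub Aq Atot.
pose E x := [set s x | s in A].
have Elb x : P x -> has_lbound (E x).
  move=> Px; exists (- q (- x)) => _ [s As <-].
  have := sublinear_onN (Asub _ As) Px.
  by have := Aq _ _ As (subspaceN Px); lra.
have E0 x : E x !=set0 by exists (s0 x), s0.
have le s x : A s -> P x -> inf (E x) <= s x.
  by move=> As Px; apply: ge_inf; [exact: Elb|exists s].
exists (fun x => inf (E x)); split; last 2 first.
- by move=> x Px; exact: le_trans (le _ _ As0 Px) (Aq _ _ As0 Px).
- exact: le.
split=> [x y Px Py|k x k0 Px].
  rewrite -lerBlDr; apply: lb_le_inf => // _ [s1 As1 <-].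
  rewrite lerBlDr -lerBlDl; apply: lb_le_inf => // _ [s2 As2 <-].
  rewrite lerBlDl.
  have Pxy := hP.1 _ _ Px Py.
  have [h|h] := Atot _ _ As1 As2.
    have := le _ _ As1 Pxy; have := (Asub _ As1).1 _ _ Px Py.
    by have := h y Py; lra.
  have := le _ _ As2 Pxy; have := (Asub _ As2).1 _ _ Px Py.
  by have := h x Px; lra.
move: k0; rewrite (le_eqVlt 0 k) => /orP[/eqP<-|k0].
  have := le _ _ As0 (hP.2 0 _ Px).
  by rewrite (sublinear_onZ (Asub _ As0))// !mul0r.
rewrite mulrC -ler_pdivrMr//; apply: lb_le_inf => // _ [s As <-].
rewrite ler_pdivrMr// mulrC -(sublinear_onZ (Asub _ As) (ltW k0) Px).
by apply: le => //; exact: hP.2.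
Qed.

(** The infimum of [q (x + k *: y) - k * q y] over [k >= 0] lies below [q] by [k = 0], and [k = 1]
    at [x = - y] gives the bound [- q y]. A minimal [q] is therefore odd. *)
Lemma sublinear_improve q y : sublinear_on P q -> P y ->
  exists t, [/\ sublinear_on P t, forall x, P x -> t x <= q x &
    t (- y) <= - q y].
Proof.
move=> qs Py; have [qD qZ] := qs.
pose E x := [set q (x + k *: y) - k * q y | k in [set k | 0 <= k]].
have E0 x : E x !=set0 by exists (q (x + 0 *: y) - 0 * q y); exists 0 => /=.
have Elb x : P x -> has_lbound (E x).
  move=> Px; exists (- q (- x)) => _ [k /= k0 <-].
  rewrite -(sublinear_onZ qs k0 Py).
  have := qD (x + k *: y) (- x) (hP.1 _ _ Px (hP.2 _ _ Py)) (subspaceN Px).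
  by rewrite addrAC subrr add0r; lra.
have le x k : P x -> 0 <= k -> inf (E x) <= q (x + k *: y) - k * q y.
  by move=> Px k0; apply: ge_inf; [exact: Elb|exists k].
exists (fun x => inf (E x)); split.
- split=> [x z Px Pz|k x k0 Px].
    rewrite -lerBlDr; apply: lb_le_inf => // _ [k1 /= k10 <-].
    rewrite lerBlDr -lerBlDl; apply: lb_le_inf => // _ [k2 /= k20 <-].
    rewrite lerBlDl.
    have := le (x + z) (k1 + k2) (hP.1 _ _ Px Pz) (addr_ge0 k10 k20).
    have := qD (x + k1 *: y) (z + k2 *: y)
      (hP.1 _ _ Px (hP.2 _ _ Py)) (hP.1 _ _ Pz (hP.2 _ _ Py)).
    by rewrite addrACA -scalerDl mulrDl; lra.
  move: k0; rewrite (le_eqVlt 0 k) => /orP[/eqP<-|k0].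
    have := le (0 *: x) 0 (hP.2 _ _ Px) (lexx _).
    by rewrite !mul0r subr0 -scalerDr (sublinear_onZ qs) ?mul0r//; exact: hP.1.
  rewrite mulrC -ler_pdivrMr//; apply: lb_le_inf => // _ [h /= h0 <-].
  rewrite ler_pdivrMr//.
  apply: (le_trans (le _ (k * h) (hP.2 _ _ Px) (mulr_ge0 (ltW k0) h0))).
  rewrite -scalerA -scalerDr (sublinear_onZ qs (ltW k0)); first lra.
  by apply: hP.1 => //; exact: hP.2.
- by move=> x Px; have := le x 0 Px (lexx _); rewrite scale0r addr0; lra.
- have := le _ 1 (subspaceN Py) ler01; rewrite scale1r addNr.
  have : q (0 *: y) = 0 by rewrite (sublinear_onZ qs)// mul0r.
  by rewrite scale0r => ->; lra.
Qed.

(** Zorn's lemma gives a minimal sublinear functional below [q]; it is odd by [sublinear_improve],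
    and an odd sublinear functional is linear. *)
Theorem hahn_banach q : sublinear_on P q ->
  exists l, linear_on P l /\ forall x, P x -> l x <= q x.
Proof.
move=> qs.
pose T := {s : V -> R | sublinear_on P s /\ forall x, P x -> s x <= q x}.
(* The order is reversed, so Zorn's maximal elements are minimal functionals. Only values on [P] are
   compared, hence a preorder. *)
pose leT (s t : T) := `[< forall x, P x -> sval t x <= sval s x >].
have q0 : sublinear_on P q /\ forall x, P x -> q x <= q x by [].
have [||A Atot|[s [ss sq]] smax] := @ZL_preorder T (exist _ q q0) leT.
- by move=> t; apply/asboolP.
- move=> r s t /asboolP rs /asboolP st; apply/asboolP => x Px.
  exact: le_trans (st x Px) (rs x Px).
- have [[s0 As0]|Ae] := pselect (A !=set0); last first.
    by exists (exist _ q q0) => s As; exfalso; apply: Ae; exists s.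
  have [||||t [ts tq tA]] := @sublinear_inf_chain q [set sval s | s in A].
  + by exists (sval s0), s0.
  + by move=> _ [s As <-]; exact: (svalP s).1.
  + by move=> _ x [s As <-] Px; exact: (svalP s).2.
  + move=> _ _ [s As <-] [t At <-].
    by have [/asboolP|/asboolP] := Atot _ _ As At; [right|left].
  + exists (exist _ t (conj ts tq)) => s As; apply/asboolP => x Px /=.
    by apply: tA => //; exists s.
have sN y : P y -> s (- y) = - s y.
  move=> Py; have [t [ts tle ty]] := sublinear_improve ss Py.
  have tq x : P x -> t x <= q x.
    by move=> Px; exact: le_trans (tle x Px) (sq x Px).
  have /smax/asboolP/(_ _ (subspaceN Py))/= : 
    leT (exist _ s (conj ss sq)) (exist _ t (conj ts tq)) by apply/asboolP.
  by have := sublinear_onN ss (subspaceN Py); rewrite opprK; lra.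
(* Oddness turns subadditivity at [- x] and [- y] into the opposite inequality. *)
exists s; split=> //; split=> [x y Px Py|k x Px].
  have := ss.1 _ _ Px Py.
  have := ss.1 _ _ (subspaceN Px) (subspaceN Py).
  by rewrite -opprD !sN//; [lra|exact: hP.1].
have [k0|k0] := leP 0 k; first exact: (sublinear_onZ ss).
have := sublinear_onZ ss (k := - k) _ Px.
rewrite scaleNr sN; last exact: hP.2.
by rewrite oppr_ge0 => /(_ (ltW k0)); lra.
Qed.

End HahnBanach.

(** * Borel measures from finitely additive ones *)

Section FinitelyAdditive.
Context {R : realType} {T : pseudoPMetricType R}.

(** The inner parallel set at radius [1/(n+1)]; for open [O] these sets increase to [O]. *)
Definition erode (O : set T) (n : nat) : set T :=
  [set x | ball x n.+1%:R^-1 `<=` O].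

Lemma erode_sub O n : erode O n `<=` O.
Proof. by move=> x; apply; apply: ballxx; rewrite invr_gt0 ltr0n. Qed.

Lemma erode_homo O U n k : O `<=` U -> (n <= k)%N -> erode O n `<=` erode U k.
Proof.
move=> OU nk x xO; apply: subset_trans OU; apply: subset_trans xO.
by apply: le_ball; rewrite lef_pV2 ?posrE ?ltr0n// ler_nat.
Qed.

Lemma open_erode O x : open O -> O x -> \forall n \near \oo, erode O n x.
Proof.
move=> oO Ox; have /nbhs_ballP[e e0 eO] := open_nbhs_nbhs (conj oO Ox).
near=> n; apply: subset_trans eO; apply: le_ball.
by apply: ltW; near: n; exact: (near_infty_natSinv_lt (PosNum e0)).
Unshelve. all: by end_near. Qed.

(* An open cover of a compact set [K] is Lebesgue-uniform on each [erode O n],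
   whose closure lies in [O]. *)
Lemma compact_erode_cover (K : set T) (F : (set T)^nat) n : compact K ->
  (forall i, open (F i)) ->
  exists k, K `&` erode (\bigcup_i F i) n `<=`
    \big[setU/set0]_(i < k) erode (F i) k.
Proof.
move=> /compact_near_coveringP cK oF; set O := \bigcup_i F i.
have : \forall k \near \oo, K `<=` [set x | erode O n x ->
    exists2 i, (i < k)%N & erode (F i) k x].
  apply: cK => x Kx.
  have [[i _ Fix]|nOx] := pselect (O x).
    have [N _ hN] := open_erode (oF i) Fix.
    (* Half the radius is spent on moving from [x] to [y], the other half on the ball around [y]. *)
    have e0 : 0 < (N.+1%:R^-1 / 2 : R) by rewrite divr_gt0// invr_gt0 ltr0n.
    exists (ball x (N.+1%:R^-1 / 2),
        [set k | (i < k)%N /\ (k.+1%:R^-1 < N.+1%:R^-1 / 2 :> R)]).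
      split=> /=; first exact: nbhsx_ballx.
      apply: filterI; first exact: nbhs_infty_gt.
      exact: (near_infty_natSinv_lt (PosNum e0)).
    move=> [y k] [/= xy [ik kN]] _; exists i => //.
    apply: subset_trans (hN _ (leqnn N)) => z yz.
    rewrite (splitr N.+1%:R^-1); apply: (ball_triangle xy).
    exact: le_ball (ltW kN) _ yz.
  (* Near a point [x] outside [O] nothing has to be covered: no [y] within [1/(n+1)] of [x] lies in
     [erode O n]. *)
  exists (ball x n.+1%:R^-1, setT).
    split=> /=; last exact: filterT.
    by apply: nbhsx_ballx; rewrite invr_gt0 ltr0n.
  move=> [y k] [/= xy _] Oy; exfalso; apply: nOx; apply: Oy.
  exact: ball_sym.
move=> [k _ /(_ k (leqnn k)) hk]; exists k => x [Kx Ox].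
have [i ik Fi] := hk _ Kx Ox.
by rewrite -(bigcup_mkord _ (fun i => erode (F i) k)); exists i.
Qed.

Context (K : set T) (m : set T -> R).
Hypotheses (cK : compact K) (m_ge0 : forall A, 0 <= m A)
  (mU : forall A B, A `&` B = set0 -> m (A `|` B) = m A + m B)
  (mT : m setT = 1) (mNK : m (~` K) = 0).

Let m0 : m set0 = 0.
Proof. by have := mU (setI0 set0); rewrite setU0; lra. Qed.

Let le_m A B : A `<=` B -> m A <= m B.
Proof. by move=> AB; rewrite -(setDUK AB) mU ?lerDl// setDIK. Qed.

Let le_mU A B : m (A `|` B) <= m A + m B.
Proof.
rewrite -(setDUK (@subsetUl _ A B)) mU ?setDIK// lerD2l; apply: le_m.
by rewrite setDUD setDv set0U; exact: subDsetl.
Qed.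

Let le_msum (F : (set T)^nat) n :
  m (\big[setU/set0]_(i < n) F i) <= \sum_(i < n) m (F i).
Proof.
elim: n => [|n IH]; first by rewrite !big_ord0 m0.
by rewrite !big_ord_recr/=; apply: le_trans (le_mU _ _) _; rewrite lerD2r.
Qed.

Let mIK A : m A = m (K `&` A).
Proof.
apply/eqP; rewrite eq_le; apply/andP; split; last by apply: le_m; exact: subIsetr.
rewrite -{1}(setUIDK A K) setIC; apply: le_trans (le_mU _ _) _.
rewrite -[leRHS]addr0 lerD2l -mNK setDE; apply: le_m; exact: subIsetr.
Qed.

(** The supremum over erosions drops the mass that [m], being only finitely additive, may leave
    along the boundary of [O]; this gives countable subadditivity on open sets. *)
Definition inner_mass (O : set T) : \bar R :=
  ereal_sup [set (m (erode O n))%:E | n in [set: nat]].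

Definition outer_mass (A : set T) : \bar R :=
  ereal_inf [set inner_mass O | O in [set O | open O /\ A `<=` O]].

Local Open Scope ereal_scope.

Let erode_le_inner O n : (m (erode O n))%:E <= inner_mass O.
Proof. by apply: ereal_sup_ubound; exists n. Qed.

Lemma inner_mass_ge0 O : 0 <= inner_mass O.
Proof. by apply: le_trans (erode_le_inner O 0); rewrite lee_fin. Qed.

Lemma inner_mass_le O : inner_mass O <= (m O)%:E.
Proof.
apply: ge_ereal_sup => _ [n _ <-]; rewrite lee_fin; apply: le_m.
exact: erode_sub.
Qed.

Lemma le_inner_mass O U : O `<=` U -> inner_mass O <= inner_mass U.
Proof.
move=> OU; apply: ge_ereal_sup => _ [n _ <-].
apply: le_trans (erode_le_inner U n); rewrite lee_fin; apply: le_m.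
exact: erode_homo.
Qed.

(** On [K], each erosion of the union is covered by finitely many erosions of the [F i]; since [m]
    is concentrated on [K], its finite subadditivity suffices. *)
Lemma inner_mass_bigcup (F : (set T)^nat) : (forall i, open (F i)) ->
  inner_mass (\bigcup_i F i) <= \sum_(i <oo) inner_mass (F i).
Proof.
move=> oF; apply: ge_ereal_sup => _ [n _ <-].
have [k Kk] := compact_erode_cover n cK oF.
apply: (@le_trans _ _ (\sum_(0 <= i < k) inner_mass (F i))); last first.
  by apply: nneseries_lim_ge => *; exact: inner_mass_ge0.
rewrite big_mkord mIK.
apply: (@le_trans _ _ (\sum_(i < k) (m (erode (F i) k))%:E)).
  rewrite sumEFin lee_fin; apply: le_trans (le_msum (fun i => erode (F i) k) k).
  exact: le_m.
by apply: lee_sum => i _.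
Qed.

Lemma outer_mass_open O : open O -> outer_mass O = inner_mass O.
Proof.
move=> oO; apply/eqP; rewrite eq_le; apply/andP; split.
  by apply: ereal_inf_lbound; exists O => //; split.
by apply: le_ereal_inf_tmp => _ [U [_ OU] <-]; exact: le_inner_mass.
Qed.

Lemma outer_mass0 : outer_mass set0 = 0.
Proof.
rewrite outer_mass_open; last exact: open0.
apply/eqP; rewrite eq_le inner_mass_ge0 andbT.
by apply: le_trans (inner_mass_le _) _; rewrite m0.
Qed.

Lemma outer_mass_ge0 A : 0 <= outer_mass A.
Proof. by apply: le_ereal_inf_tmp => _ [U _ <-]; exact: inner_mass_ge0. Qed.

Lemma le_outer_mass : {homo outer_mass : A B / A `<=` B >-> A <= B}.
Proof.
move=> A B AB; apply: ereal_inf_le_tmp => _ [U [oU BU] <-].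
by exists U => //; split=> //; exact: subset_trans BU.
Qed.

Lemma outer_massT : outer_mass setT = 1.
Proof.
rewrite outer_mass_open; last exact: openT.
apply/eqP; rewrite eq_le; apply/andP; split.
  by apply: le_trans (inner_mass_le _) _; rewrite mT.
by apply: le_trans (erode_le_inner _ 0); rewrite lee_fin -mT; exact: le_m.
Qed.

Let outer_mass_fin A : outer_mass A \is a fin_num.
Proof.
rewrite ge0_fin_numE ?outer_mass_ge0//.
apply: (@le_lt_trans _ _ 1); last exact: ltry.
by rewrite -outer_massT; exact: le_outer_mass.
Qed.

Lemma outer_mass_adherent A (e : R) : (0 < e)%R ->
  exists O, [/\ open O, A `<=` O & inner_mass O < outer_mass A + e%:E].
Proof.
move=> e0; have [_ [U [oU AU] <-] Ult] := lb_ereal_inf_adherent e0 (outer_mass_fin A).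
by exists U.
Qed.

Lemma outer_mass_sigma_subadditive : sigma_subadditive outer_mass.
Proof.
move=> A; apply/lee_addgt0Pr => e e0.
apply: le_trans (epsilon_trick xpredT (fun n => outer_mass_ge0 (A n)) (ltW e0)).
have /choice[ O hO] : forall n, exists O, [/\ open O, A n `<=` O &
    inner_mass O < outer_mass (A n) + (e / (2 ^ n.+1)%:R)%:E].
  by move=> n; apply: outer_mass_adherent; rewrite divr_gt0// ltr0n expn_gt0.
have oO n : open (O n) by case: (hO n).
apply: (@le_trans _ _ (outer_mass (\bigcup_n O n))).
  apply: le_outer_mass => x [n _ Anx]; exists n => //.
  by case: (hO n) => _ + _; exact.
rewrite outer_mass_open; last exact: bigcup_open.
apply: (le_trans (inner_mass_bigcup oO)).
apply: lee_nneseries => [n _ _|n _]; first exact: inner_mass_ge0.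
by case: (hO n) => _ _ /ltW.
Qed.

HB.instance Definition _ := isOuterMeasure.Build R T outer_mass outer_mass0
  outer_mass_ge0 le_outer_mass outer_mass_sigma_subadditive.

(** Let an open [O] nearly realize the outer mass of [A]. Each erosion of the intersection of [O]
    and [U] is disjoint from an open [W] containing [A] minus [U], and [m] is additive on disjoint
    sets. *)
Lemma open_caratheodory U : open U -> outer_mass.-caratheodory U.
Proof.
move=> oU; apply: le_caratheodory_measurable => A.
apply/lee_addgt0Pr => e e0.
have [ O [oO AO /ltW Olt]] := outer_mass_adherent A e0.
apply: le_trans Olt.
have oOU : open (O `&` U) by exact: openI.
apply: (@le_trans _ _ (inner_mass (O `&` U) + outer_mass (A `&` ~` U))).
  by rewrite leeD2r// -outer_mass_open//; apply: le_outer_mass; exact: setSI.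
rewrite -leeBrDr//; apply: ge_ereal_sup => _ [n _ <-].
rewrite leeBrDr// addeC -leeBrDr//.
(* Points of [A] outside [U] belong to [W]: the balls of radius [1/(n+1)] about points of the
   erosion lie in [U], so these points keep that distance from it. *)
pose W := O `&` (~` erode (O `&` U) n)°.
have oW : open W by apply: openI => //; exact: open_interior.
apply: (@le_trans _ _ (outer_mass W)).
  apply: le_outer_mass => x [Ax nUx]; split; first exact: AO.
  apply/nbhs_ballP; exists n.+1%:R^-1%R => /=; first by rewrite invr_gt0 ltr0n.
  by move=> y xy Ey; apply: nUx; apply: (Ey x _).2; exact: ball_sym.
rewrite outer_mass_open//; apply: ge_ereal_sup => _ [k _ <-].
rewrite leeBrDr// -EFinD -mU; last first.
  rewrite -subset0 => x [/erode_sub[_ /interior_subset]].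
  exact.
(* Both pieces lie in one erosion of [O], at the finer of the two radii. *)
apply: le_trans (erode_le_inner O (maxn k n)); rewrite lee_fin.
apply: le_m => x []; apply: erode_homo; rewrite ?leq_maxl ?leq_maxr//;
  exact: subIsetl.
Qed.

(** The outer mass retyped on the Borel sigma-algebra, to carry the measure structure. *)
Definition borel_mass : set (g_sigma_algebraType (@open T)) -> \bar R :=
  outer_mass.

Let measurable_caratheodory (A : set (g_sigma_algebraType (@open T))) :
  measurable A -> outer_mass.-caratheodory A.
Proof.
have := @smallest_sub _ (sigma_algebra setT) (@open T)
  (@measurable _ (caratheodory_type outer_mass)).
apply; first exact: sigma_algebra_measurable.
exact: open_caratheodory.
Qed.

Let borel_mass_sigma_additive : semi_sigma_additive borel_mass.
Proof.
move=> F mF tF mUF.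
apply: (@caratheodory_measure_sigma_additive R T outer_mass F) => //.
  by move=> i; exact: measurable_caratheodory.
exact: measurable_caratheodory.
Qed.

HB.instance Definition _ := isMeasure.Build _ _ _ borel_mass outer_mass0
  outer_mass_ge0 borel_mass_sigma_additive.

HB.instance Definition _ :=
  Measure_isProbability.Build _ _ _ borel_mass outer_massT.

(** On open [O] the measure is [inner_mass O], a supremum of values of [m] on subsets of [O]. *)
Theorem finitely_additive_dominates_borel :
  exists nu : probability (g_sigma_algebraType (@open T)) R,
    forall O, open O -> nu O <= (m O)%:E.
Proof.
exists borel_mass => O oO.
by have := inner_mass_le O; rewrite -outer_mass_open.
Qed.

End FinitelyAdditive.

(** * The cone of minimal plurisubharmonic functions *)

Section UpperSemicontinuous.
Context {R : realType}.
Local Open Scope ereal_scope.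

(** Between finite values the slack [a - (x + y)] is shared equally; a value [-oo] takes whatever
    bound the other leaves. *)
Lemma lte_fin_split (x y : \bar R) (a : R) : x < +oo -> y < +oo ->
  x + y < a%:E -> exists b c : R, [/\ x < b%:E, y < c%:E & (b + c = a)%R].
Proof.
case: x => [x| |]//; case: y => [y| |]// _ _.
- rewrite -EFinD lte_fin => xya; pose e : R := ((a - (x + y)) / 2)%R.
  by exists (x + e)%R, (y + e)%R; rewrite !lte_fin /e; split; lra.
- by exists (x + 1)%R, (a - (x + 1))%R; rewrite lte_fin ltNyr; split=> //; lra.
- by exists (a - (y + 1))%R, (y + 1)%R; rewrite lte_fin ltNyr; split=> //; lra.
- by exists 0%R, a; rewrite !ltNyr add0r.
Qed.

Context {T : topologicalType}.
Implicit Types (D : set T) (u v : T -> \bar R).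

Lemma usc_onD D u v : (forall x, D x -> u x < +oo) ->
  (forall x, D x -> v x < +oo) -> usc_on D u -> usc_on D v ->
  usc_on D (fun x => u x + v x).
Proof.
move=> uoo voo cu cv x Dx a /(lte_fin_split (uoo _ Dx) (voo _ Dx)).
move=> [b [c [ub vc bca]]].
apply: filterS2 (cu x Dx _ ub) (cv x Dx _ vc) => y uy vy.
by rewrite -bca EFinD; exact: lteD.
Qed.

Lemma usc_onZ D (k : R) u : (0 < k)%R -> usc_on D u ->
  usc_on D (fun x => k%:E * u x).
Proof.
move=> k0 cu x Dx a; have e y : (k%:E * u y < a%:E) = (u y < (k^-1 * a)%:E).
  rewrite -[LHS](@lte_pmul2l _ (k^-1)%:E) ?lte_fin ?invr_gt0// muleA -!EFinM.
  by rewrite mulVf ?gt_eqF// mul1e.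
by rewrite e => /(cu x Dx); apply: filterS => y; rewrite e.
Qed.

Lemma usc_on_cst D (r : \bar R) : usc_on D (cst r).
Proof. by move=> x _ a ra; near=> y. Unshelve. all: by end_near. Qed.

Lemma usc_openP u : usc_on setT u -> forall a : R, open [set x | u x < a%:E].
Proof.
move=> cu a; rewrite openE => x /= uxa; rewrite /interior.
by have := cu x I a uxa; rewrite withinET.
Qed.

Lemma usc_comp (S : topologicalType) (f : S -> T) u :
  continuous f -> usc_on setT u -> usc_on setT (u \o f).
Proof.
move=> cf cu x _ a /= uxa; rewrite withinET.
by have := cu (f x) I a uxa; rewrite withinET; exact: cf.
Qed.

Lemma usc_compact_bounded (K : set T) u : compact K -> usc_on setT u ->
  (forall x, u x < +oo) -> exists2 M : R, (0 <= M)%R &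
    forall x, K x -> u x <= M%:E.
Proof.
move=> /compact_near_coveringP cK cu uoo.
have : \forall n \near \oo, K `<=` [set x | u x < n%:R%:E].
  apply: (cK nat \oo (fun n x => u x < n%:R%:E)) => x Kx.
  have [a uxa] : exists a : R, u x < a%:E.
    case: (u x) (uoo x) => [r _| |]//; last by exists 0%R; rewrite ltNyr.
    by exists (r + 1)%R; rewrite lte_fin; lra.
  exists ([set y | u y < a%:E], [set n | (a <= n%:R)%R]).
    split=> /=; last exact: nbhs_infty_ger.
    by have := cu x I a uxa; rewrite withinET.
  by move=> [y n] [/= uya an]; apply: lt_le_trans uya _; rewrite lee_fin.
move=> [n _ /(_ n (leqnn n)) Kn]; exists n%:R%R => // x Kx.
exact/ltW/Kn.
Qed.

Lemma measurable_fun_sublevel (d : measure_display) (S : measurableType d)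
  (f : S -> \bar R) : (forall a : R, measurable [set x | f x < a%:E]) ->
  measurable_fun setT f.
Proof.
move=> mf; rewrite (_ : f = (fun x => - (- f x))); last first.
  by apply/funext => x; rewrite oppeK.
apply: measurableT_comp => //.
apply: (measurability _ (ErealGenOInfty.measurableE R)) => // _ [_ [a ->] <-].
rewrite setTI preimage_itvoy [X in measurable X](_ : _ = [set x | f x < (- a)%:E])//.
by apply/seteqP; split=> x /=; rewrite EFinN lteNr.
Qed.

End UpperSemicontinuous.

(** * Integrals of functions with values in the extended reals *)

Section Integral.
Context (d : measure_display) (T : measurableType d) (R : realType)
  (mu : {measure set T -> \bar R}) (D : set T) (mD : measurable D).
Local Open Scope ereal_scope.
Implicit Types f g : T -> \bar R.

(** Positive parts compare in one direction and negative parts in the other, so infinite integrals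
    are covered too. *)
Lemma le_integral_measurable f g : measurable_fun D f -> measurable_fun D g ->
  (forall x, D x -> f x <= g x) ->
  \int[mu]_(x in D) f x <= \int[mu]_(x in D) g x.
Proof.
move=> mf mg fg; rewrite integralE [leRHS]integralE; apply: leeB.
  apply: ge0_le_integral => //; try exact: measurable_funepos.
  by move=> x Dx; rewrite !funeposE ge_max !le_max lexx orbT andbT fg.
apply: ge0_le_integral => //; try exact: measurable_funeneg.
by move=> x Dx; rewrite !funenegE ge_max !le_max lexx orbT andbT leeN2 fg.
Qed.

(** The positive part has integral at most [M * mu D], so an integral other than [-oo] forces a
    finite negative part. *)
Lemma integrable_bounded_above f (M : R) : mu D < +oo -> (0 <= M)%R ->
  measurable_fun D f -> (forall x, D x -> f x <= M%:E) ->
  \int[mu]_(x in D) f x != -oo -> mu.-integrable D f.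
Proof.
move=> Doo M0 mf fM; rewrite integralE => intf.
have mp := measurable_funepos mf; have mn := measurable_funeneg mf.
have poo : \int[mu]_(x in D) f^\+ x < +oo.
  apply: (@le_lt_trans _ _ (\int[mu]_(x in D) cst M%:E x)).
    apply: ge0_le_integral => // x Dx.
    by rewrite funeposE ge_max lee_fin M0 fM.
  by rewrite integral_cst// lte_mul_pinfty// lee_fin.
have p0 : 0 <= \int[mu]_(x in D) f^\+ x by exact: integral_ge0.
have n0 : 0 <= \int[mu]_(x in D) f^\- x by exact: integral_ge0.
apply/integrableP; split=> //.
rewrite (_ : \int[mu]_(x in D) _ = \int[mu]_(x in D) (f^\+ x + f^\- x)).
  rewrite ge0_integralD//.
  move: intf poo p0 n0; case: (\int[mu]_(x in D) f^\+ x) => [r| |]//.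
  by case: (\int[mu]_(x in D) f^\- x) => [s| |]//= _ _ _ _; rewrite -EFinD ltry.
by apply: eq_integral => x _; have /(congr1 (@^~ x)) := fune_abse f.
Qed.

End Integral.

(** * Submean inequalities over circles *)

Section Circles.
Context {R : realType}.
Local Open Scope ereal_scope.
Implicit Types (u v : R * R -> \bar R) (c : R * R) (r : R).

Lemma circle_pt_continuous c r : continuous (circle_pt c r).
Proof.
move=> t; apply: (@cvg_pair _ _ _ _ (nbhs _) (nbhs _)).
  by apply: cvgD; [exact: cvg_cst|apply: cvgM; [exact: cvg_cst|exact: continuous_cos]].
by apply: cvgD; [exact: cvg_cst|apply: cvgM; [exact: cvg_cst|exact: continuous_sin]].
Qed.

Let mu := @lebesgue_measure R.
Let D : set R := `[0%R, (2 * pi)%R]%classic.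

Let muD : mu D = (2 * pi)%:E.
Proof.
rewrite /mu /D lebesgue_measure_itv/= lte_fin mulr_gt0 ?pi_gt0//.
by rewrite sube0.
Qed.

Let pi2_gt0 : (0 < (2 * pi)^-1 :> R)%R.
Proof. by rewrite invr_gt0 mulr_gt0// pi_gt0. Qed.

Lemma usc_circle_measurable u c r : usc_on setT u ->
  measurable_fun setT (fun t : R => u (circle_pt c r t)).
Proof.
move=> cu; apply: measurable_fun_sublevel => a; apply: open_measurable.
exact: usc_openP (usc_comp (@circle_pt_continuous c r) cu) a.
Qed.

Lemma usc_circle_integrable u c r : usc_on setT u -> (forall y, u y < +oo) ->
  \int[mu]_(t in D) u (circle_pt c r t) != -oo ->
  mu.-integrable D (fun t => u (circle_pt c r t)).
Proof.
move=> cu uoo.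
have [M M0 uM] := usc_compact_bounded (@segment_compact R 0 (2 * pi))
  (usc_comp (@circle_pt_continuous c r) cu) (fun t => uoo _).
apply: (integrable_bounded_above _ _ M0) => //.
- exact: measurable_itv.
- by have := ltry (2 * pi : R); rewrite -muD.
- by apply: measurable_funTS; exact: usc_circle_measurable.
Qed.

(** A circle integral [-oo] forces the value [-oo] at the centre, where the inequality for the sum
    becomes trivial; otherwise both functions are integrable on the circle and the integrals add. *)
Lemma subharmonicD u v : subharmonic setT u -> subharmonic setT v ->
  subharmonic setT (fun y => u y + v y).
Proof.
move=> [uoo cu su] [voo cv sv].
split=> [y _||c r r0 cD].
- by apply: lte_add_pinfty; [exact: uoo|exact: voo].
- exact: usc_onD.
- have := su c r r0 cD; have := sv c r r0 cD; rewrite -/mu -/D.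
  have [->|intu] := eqVneq (\int[mu]_(t in D) u (circle_pt c r t)) -oo.
    by rewrite gt0_muleNy ?lte_fin// leeNy_eq => _ /eqP ->; rewrite addNye leNye.
  have [->|intv] := eqVneq (\int[mu]_(t in D) v (circle_pt c r t)) -oo.
    by rewrite gt0_muleNy ?lte_fin// leeNy_eq => /eqP -> _; rewrite addeNy leNye.
  have iu := usc_circle_integrable cu (fun y => uoo y I) intu.
  have iv := usc_circle_integrable cv (fun y => voo y I) intv.
  rewrite integralD//; last exact: measurable_itv.
  move=> hv hu; rewrite muleDr//; first exact: leeD.
  by apply: fin_num_adde_defr; apply: integrable_fin_num iu; exact: measurable_itv.
Qed.

Lemma subharmonicZ (k : R) u : (0 < k)%R -> subharmonic setT u ->
  subharmonic setT (fun y => k%:E * u y).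
Proof.
move=> k0 [uoo cu su]; split=> [y _||c r r0 cD].
- by apply: lte_mul_pinfty => //; [rewrite lee_fin ltW|exact: uoo].
- exact: usc_onZ.
- have := su c r r0 cD; rewrite -/mu -/D.
  have [->|intu] := eqVneq (\int[mu]_(t in D) u (circle_pt c r t)) -oo.
    rewrite gt0_muleNy ?lte_fin// leeNy_eq => /eqP ->.
    by rewrite gt0_muleNy ?lte_fin// leNye.
  have iu := usc_circle_integrable cu (fun y => uoo y I) intu.
  rewrite integralZl//; last exact: measurable_itv.
  by rewrite muleCA lee_pmul2l// lte_fin.
Qed.

Lemma subharmonic_cst (b : R) : subharmonic setT (cst b%:E).
Proof.
split=> [y _||c r r0 _]; [exact: ltry|exact: usc_on_cst|].
rewrite integral_cst/=; last exact: measurable_itv.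
rewrite -/mu -/D muD -!EFinM lee_fin mulrCA mulVf ?mulr1//.
by rewrite gt_eqF// -invr_gt0.
Qed.

End Circles.

(** * Cone properties on affine planes *)

Section MPshCone.
Context {R : realType} {n : nat}.
Local Open Scope ereal_scope.
Implicit Types u v : 'rV[R]_n -> \bar R.

Lemma MPshD u v : MPsh setT u -> MPsh setT v -> MPsh setT (fun x => u x + v x).
Proof.
move=> [uoo cu su] [voo cv sv]; split=> [x _||a v1 v2 d0 dE v0].
- by apply: lte_add_pinfty; [exact: uoo|exact: voo].
- exact: usc_onD.
- exact: subharmonicD (su a v1 v2 d0 dE v0) (sv a v1 v2 d0 dE v0).
Qed.

Lemma MPshZ (k : R) u : (0 < k)%R -> MPsh setT u ->
  MPsh setT (fun x => k%:E * u x).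
Proof.
move=> k0 [uoo cu su]; split=> [x _||a v1 v2 d0 dE v0].
- by apply: lte_mul_pinfty => //; [rewrite lee_fin ltW|exact: uoo].
- exact: usc_onZ.
- exact: subharmonicZ k0 (su a v1 v2 d0 dE v0).
Qed.

Lemma MPsh_cst (b : R) : MPsh setT (cst b%:E : 'rV[R]_n -> \bar R).
Proof.
split=> [x _||a v1 v2 _ _ _]; [exact: ltry|exact: usc_on_cst|].
exact: subharmonic_cst.
Qed.

End MPshCone.

(** * Jensen measures *)

(** Counting the levels [k * e] below [y] rounds [y] up to a multiple of [e], capped at [n * e]. The
    middle clause carries the induction while levels are still below [y]. *)
Lemma layer_cake_step (R : realType) (e y : R) n : 0 < e -> 0 <= y ->
  let S := \sum_(k < n) e * (k%:R * e < y)%R%:R in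
  [/\ y <= n%:R * e -> y <= S, n%:R * e <= y -> S = n%:R * e & S <= y + e].
Proof.
move=> e0 y0 /=; elim: n => [|n [IH1 IH2 IH3]].
  by rewrite big_ord0 mul0r; split=> //; lra.
rewrite big_ord_recr/= -[n.+1%:R]natr1 mulrDl mul1r.
case: ltP => ny.
  by rewrite (IH2 (ltW ny)) mulr1; split=> //; lra.
rewrite mulr0 addr0; split=> //; first by move=> _; exact: IH1.
by move=> ?; exfalso; lra.
Qed.

(** * Bounded functions and Borel sets *)

Section BoundedFunctions.
Context {R : realType} {T : Type}.

Definition bounded_funs : set (T -> R) :=
  [set f | exists M : R, forall x, `|f x| <= M].

Lemma bounded_funs_subspace : subspace bounded_funs.
Proof.
split=> [f g [M fM] [N gN]|k f [M fM]].
  by exists (M + N) => x; apply: le_trans (ler_normD _ _) _; exact: lerD.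
by exists (`|k| * M) => x; rewrite normrM ler_wpM2l.
Qed.

Lemma bounded_funs_cst (b : R) : bounded_funs (cst b).
Proof. by exists `|b|. Qed.

Lemma bounded_funs_indic A : bounded_funs \1_A.
Proof.
by exists 1 => x; rewrite indicE; case: (x \in A); rewrite ?normr1 ?normr0.
Qed.

End BoundedFunctions.

Section Borel.
Context {R : realType} {T : pseudoPMetricType R}.

Lemma open_borel (O : set T) : open O ->
  measurable (O : set (g_sigma_algebraType (@open T))).
Proof. by move=> oO; exact: sub_gen_smallest. Qed.

Lemma compact_borel (K : set T) : hausdorff_space T -> compact K ->
  measurable (K : set (g_sigma_algebraType (@open T))).
Proof.
move=> hT cK; rewrite -(setCK K); apply: measurableC; apply: open_borel.
by apply: closed_openC; exact: compact_closed.
Qed.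

End Borel.

(** * Positive functionals on lower semicontinuous functions *)

Section PositiveFunctional.
Context {R : realType} {T : pseudoPMetricType R}.
Context (K : set T) (l : (T -> R) -> R).
Hypotheses (hT : hausdorff_space T) (cK : compact K)
  (llin : linear_on bounded_funs l)
  (l_ge0 : forall f, bounded_funs f -> (forall x, K x -> 0 <= f x) -> 0 <= l f)
  (l1 : l (cst 1) = 1).

Let P := @bounded_funs R T.
Let Psub := @bounded_funs_subspace R T.

Let lB f g : P f -> P g -> l (f - g) = l f - l g.
Proof.
move=> Pf Pg; rewrite llin.1//; last exact: (subspaceN Psub).
by rewrite -scaleN1r llin.2// mulN1r.
Qed.

Let le_l f g : P f -> P g -> (forall x, K x -> f x <= g x) -> l f <= l g.
Proof.
move=> Pf Pg fg; rewrite -subr_ge0 -lB//; apply: l_ge0.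
  by apply: Psub.1 => //; exact: (subspaceN Psub).
by move=> x Kx; rewrite subr_ge0; exact: fg.
Qed.

Let l_cst b : l (cst b) = b.
Proof.
rewrite (_ : cst b = b *: cst 1); last by apply/funext => x; exact/esym/mulr1.
by rewrite llin.2 ?l1 ?mulr1//; exact: bounded_funs_cst.
Qed.

Let m A := l \1_A.

Let mT : m setT = 1.
Proof. by rewrite /m indicT l1. Qed.

Let m_ge0 A : 0 <= m A.
Proof.
apply: l_ge0; first exact: bounded_funs_indic.
by move=> x _; rewrite indicE.
Qed.

Let mU A B : A `&` B = set0 -> m (A `|` B) = m A + m B.
Proof.
move=> AB; rewrite /m -llin.1; try exact: bounded_funs_indic.
congr l; apply/funext => x.
rewrite (_ : (\1_A + \1_B) x = \1_A x + \1_B x)// !indicE in_setU.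
have nAB : ~ (A x /\ B x) by move=> ABx; have : (A `&` B) x by []; rewrite AB.
case: (boolP (x \in A)) => [/set_mem xA|_]; last by rewrite add0r.
case: (boolP (x \in B)) => [/set_mem xB|_]; last by rewrite addr0.
by exfalso; apply: nAB.
Qed.

Let mNK : m (~` K) = 0.
Proof.
apply/eqP; rewrite eq_le m_ge0 andbT -(l_cst 0); apply: le_l.
- exact: bounded_funs_indic.
- exact: bounded_funs_cst.
- by move=> x Kx; rewrite indicE in_setC mem_set.
Qed.

Let l_sum (F : nat -> T -> R) n : (forall k, P (F k)) ->
  P (\sum_(k < n) F k) /\ l (\sum_(k < n) F k) = \sum_(k < n) l (F k).
Proof.
move=> PF; elim: n => [|n [Pn IH]].
  by rewrite !big_ord0; split; [exact: (bounded_funs_cst 0)|exact: l_cst].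
have -> : \sum_(k < n.+1) F k = \sum_(k < n) F k + F n by rewrite big_ord_recr.
split; first exact: (Psub.1 _ _ Pn (PF n)).
by rewrite (llin.1 _ _ Pn (PF n)) IH big_ord_recr.
Qed.

(** For each [e > 0], [f] is rounded up to a sum of [e] times indicators of open superlevel sets, on
    which [nu] is dominated by [m]; the sum exceeds [f] by at most [e]. *)
Theorem positive_functional_lsc :
  exists nu : probability (g_sigma_algebraType (@open T)) R,
    nu K = 1%E /\
    forall (f : T -> R) (N : R), (forall x, 0 <= f x <= N) ->
      (forall t, open [set x | t < f x]) ->
      (\int[nu]_(x in K) (f x)%:E <= (l f)%:E)%E.
Proof.
have [nu nuO] := finitely_additive_dominates_borel cK m_ge0 mU mT mNK.
have oK : open (~` K) by apply: closed_openC; exact: compact_closed.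
have mO := @open_borel R T; have mK := compact_borel hT cK.
have nuK : nu K = 1%E.
  have nuNK : nu (~` K) = 0%E.
    by apply/eqP; rewrite eq_le measure_ge0 andbT; have := nuO _ oK; rewrite mNK.
  by rewrite -(setCK K) probability_setC ?nuNK ?sube0//; exact: mO.
exists nu; split=> // f N fN of_; apply/lee_addgt0Pr => e e0.
have Pf : P f.
  by exists N => x; have /andP[f0 fN'] := fN x; rewrite ger0_norm.
(* Enough levels for [n * e] to exceed the bound [N], so that the rounding is never capped. *)
pose n := Num.bound (N / e).
have Nn x : f x <= n%:R * e.
  have /andP[f0 fN'] := fN x; apply: (le_trans fN').
  rewrite -ler_pdivrMr//; apply/ltW/archi_boundP.
  by rewrite divr_ge0 ?(ltW e0)//; exact: le_trans f0 fN'.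
pose O k : set T := [set x | k%:R * e < f x].
have oO k : open (O k) by exact: of_.
pose F k : T -> R := e *: \1_(O k).
have PF k : P (F k) by apply: Psub.2; exact: bounded_funs_indic.
have [Ps ls] := l_sum n PF.
have sE x : (\sum_(k < n) F k) x = \sum_(k < n) e * (k%:R * e < f x)%R%:R.
  rewrite fct_sumE; apply: eq_bigr => k _.
  rewrite (_ : F k x = e * \1_(O k) x)// indicE.
  suff -> : (x \in O k) = (k%:R * e < f x) by [].
  by apply/idP/idP => [/set_mem|] //; exact: mem_set.
have mF k : measurable_fun (K : set (g_sigma_algebraType (@open T)))
    (fun x => (F k x)%:E).
  apply/measurable_EFinP; apply: measurable_funM => //.
  by apply: measurable_indic; exact: mO.
have F0 k x : (0 <= (F k x)%:E)%E.
  by rewrite lee_fin mulr_ge0 ?(ltW e0)// indicE.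
apply: (@le_trans _ _ (\int[nu]_(x in K) (\sum_(k <- index_enum 'I_n) (F k x)%:E))%E).
  apply: ge0_le_integral => //.
  - by move=> x _; rewrite lee_fin; have /andP[] := fN x.
  - apply/measurable_EFinP; apply: measurable_funTS.
    apply: (measurability _ (RGenOInfty.measurableE R)) => // _ [_ [a ->] <-].
    by rewrite setTI preimage_itvoy; apply: mO; exact: of_.
  - by apply: emeasurable_sum => k; exact: mF.
  - move=> x _; rewrite sumEFin lee_fin; have := sE x; rewrite fct_sumE => ->.
    have /andP[f0 _] := fN x.
    by have [+ _ _] := layer_cake_step n e0 f0; apply.
rewrite ge0_integral_sum//.
apply: (@le_trans _ _ (\sum_(k < n) (l (F k))%:E)%E).
  apply: lee_sum => k _.
  rewrite /F llin.2; last exact: bounded_funs_indic.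
  under eq_integral do rewrite EFinM.
  rewrite ge0_integralZl//; last 2 first.
  - by apply/measurable_EFinP; apply: measurable_indic; exact: mO.
  - by rewrite lee_fin ltW.
  rewrite integral_indic//; last exact: mO.
  rewrite EFinM lee_pmul2l ?lte_fin//.
  apply: le_trans (nuO _ (oO k)); apply: le_measure; last exact: subIsetl.
  - by rewrite inE; apply: measurableI => //; exact: mO.
  - by rewrite inE; exact: mO.
(* The rounding error costs at most [e], because [l] fixes constants. *)
rewrite sumEFin -ls -EFinD lee_fin -[X in _ + X](l_cst e).
rewrite -llin.1//; last exact: bounded_funs_cst.
apply: le_l => //; first by apply: Psub.1 => //; exact: bounded_funs_cst.
move=> x _; rewrite sE; have /andP[f0 _] := fN x.
by have [_ _ +] := layer_cake_step n e0 f0.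
Qed.

End PositiveFunctional.

(** * Edwards' duality for a cone of upper semicontinuous functions *)

Section Edwards.
Context {R : realType} {T : pseudoPMetricType R}.
Context (K : set T) (p : T) (C : set (T -> \bar R)).
Hypotheses (hT : hausdorff_space T) (cK : compact K)
  (CD : forall u v, C u -> C v -> C (fun x => u x + v x)%E)
  (CZ : forall (k : R) u, 0 < k -> C u -> C (fun x => k%:E * u x)%E)
  (Cc : forall b : R, C (cst b%:E))
  (Cusc : forall u, C u -> usc_on setT u)
  (Coo : forall u x, C u -> (u x < +oo)%E)
  (Csup : forall u, C u -> (u p <= sup_on K u)%E).

Let P := @bounded_funs R T.
Let Psub := @bounded_funs_subspace R T.

(** Since [- u p] may be [+oo], it is represented by its real upper bounds [r]; the infimum is then
    taken over real numbers. *)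
Definition minorant_levels (f : T -> R) : set R :=
  [set r | exists u, [/\ C u, forall x, K x -> (u x <= (- f x)%:E)%E &
    ((- r)%:E <= u p)%E]].

Definition edwards_gauge f : R := inf (minorant_levels f).

Let E := minorant_levels.
Let q := edwards_gauge.

(** The hull condition [Csup] enters here: a competitor [u] satisfies [u p <= sup_on K u <= M]. *)
Let E_lb f : P f -> has_lbound (E f).
Proof.
move=> [M fM]; exists (- M) => r [u [Cu uf ru]].
suff : ((- r)%:E <= M%:E)%E by rewrite lee_fin; lra.
apply: (le_trans ru); apply: (le_trans (Csup Cu)).
apply: ge_ereal_sup => _ [x Kx <-]; apply: (le_trans (uf x Kx)).
by rewrite lee_fin; have := fM x; rewrite ler_norml; lra.
Qed.

Let E_neq0 f : P f -> E f !=set0.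
Proof.
move=> [M fM]; exists M, (cst (- M)%:E); split=> // x _.
by rewrite lee_fin; have := fM x; rewrite ler_norml; lra.
Qed.

Let q_le f r : P f -> E f r -> q f <= r.
Proof. by move=> Pf Er; apply: ge_inf => //; exact: E_lb. Qed.

Lemma edwards_gauge_sublinear : sublinear_on bounded_funs edwards_gauge.
Proof.
split=> [f g Pf Pg|k f k0 Pf].
  rewrite -lerBlDr; apply: lb_le_inf => [|r [u [Cu uf ru]]]; first exact: E_neq0.
  rewrite lerBlDr -lerBlDl.
  apply: lb_le_inf => [|s [v [Cv vg sv]]]; first exact: E_neq0.
  rewrite lerBlDl; apply: q_le; first exact: Psub.1.
  exists (fun x => u x + v x)%E; split=> [|x Kx|]; first exact: CD.
    by rewrite opprD EFinD; apply: leeD; [exact: uf|exact: vg].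
  by rewrite opprD EFinD; exact: leeD.
(* [C] is closed under positive multiples, so at [k = 0] the constant [0] serves as competitor. *)
move: k0; rewrite (le_eqVlt 0 k) => /orP[/eqP<-|k0].
  rewrite mul0r; apply: q_le; first exact: Psub.2.
  exists (cst 0%:E); split=> // [x _|]; last by rewrite oppr0.
  by rewrite scale0r lee_fin oppr0.
rewrite mulrC -ler_pdivrMr//.
apply: lb_le_inf => [|r [u [Cu uf ru]]]; first exact: E_neq0.
rewrite ler_pdivrMr//; apply: q_le; first exact: Psub.2.
exists (fun x => k%:E * u x)%E; split=> [|x Kx|]; first exact: CZ.
  rewrite (_ : - (k *: f) x = k * - f x); last by rewrite mulrN.
  by rewrite EFinM lee_pmul2l ?lte_fin//; exact: uf.
by rewrite mulrC -mulrN EFinM lee_pmul2l// lte_fin.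
Qed.

(** A [u] in [C] below [f] on [K] competes in the gauge of [- f], whence [l (- f) <= - a]. *)
Lemma edwards_functional : exists l : (T -> R) -> R,
  linear_on bounded_funs l /\
  forall f u (a : R), bounded_funs f -> C u ->
    (forall x, K x -> (u x <= (f x)%:E)%E) -> (a%:E <= u p)%E -> a <= l f.
Proof.
have [l [llin lq]] := hahn_banach Psub edwards_gauge_sublinear.
exists l; split=> // f u a Pf Cu uf au.
have PNf : P (- f) by exact: (subspaceN Psub).
have : l (- f) = - l f by rewrite -scaleN1r llin.2// mulN1r.
have := lq _ PNf; have : q (- f) <= - a; last by rewrite /q; lra.
apply: q_le => //; exists u; split=> //; last by rewrite opprK.
by move=> x Kx; rewrite opprK; exact: uf.
Qed.


Theorem jensen_measure :
  exists nu : probability (g_sigma_algebraType (@open T)) R,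
    nu K = 1%E /\
    forall u, C u -> (u p <= \int[nu]_(x in K) u x)%E /\
      (\int[nu]_(x in K) u x <= sup_on K u)%E.
Proof.
have [l [llin lC]] := edwards_functional.
have l_ge0 f : bounded_funs f -> (forall x, K x -> 0 <= f x) -> 0 <= l f.
  by move=> Pf f0; apply: (lC f (cst 0%:E)) => // x Kx; rewrite lee_fin f0.
have P1 : P (cst 1) by exact: bounded_funs_cst.
have lN f : P f -> l (- f) = - l f.
  by move=> Pf; rewrite -scaleN1r llin.2// mulN1r.
have l1 : l (cst 1) = 1.
  (* The constants [1] and [-1] of [C] bound [l (cst 1)] from both sides. *)
  have h1 : 1 <= l (cst 1) by apply: (lC _ (cst 1%:E)).
  have : -1 <= l (- cst 1).
    apply: (lC _ (cst (- 1)%:E)) => //; exact: (subspaceN Psub).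
  by rewrite lN//; lra.
have [nu [nuK nul]] := positive_functional_lsc hT cK llin l_ge0 l1.
have mO := @open_borel R T; have mK := compact_borel hT cK.
exists nu; split=> // u Cu.
have cu := Cusc Cu; have uoo x := Coo x Cu.
have mu : measurable_fun (K : set (g_sigma_algebraType (@open T))) u.
  apply: measurable_funTS; apply: measurable_fun_sublevel => a; apply: mO.
  exact: usc_openP.
split; last first.
  apply: (@le_trans _ _ (\int[nu]_(x in K) cst (sup_on K u) x)%E).
    apply: le_integral_measurable => // x Kx.
    by apply: ereal_sup_ubound; exists x.
  by rewrite integral_cst// [X in (_ * X)%E]nuK mule1.
have [M M0 uM] := usc_compact_bounded cK cu uoo.
case upE : (u p) (uoo p) => [a| |]// _; last exact: leNye.
(* The maximum with [0] matters only off [K], where [u] may exceed [M]. *)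
pose g x : \bar R := maxe (M%:E - u x)%E 0%E.
have g0 x : (0 <= g x)%E by rewrite le_max lexx orbT.
have gK x : K x -> g x = (M%:E - u x)%E.
  by move=> Kx; apply/max_idPl; rewrite sube_ge0 ?uM// orbT.
pose f (N : nat) x : R := fine (mine (g x) N%:R%:E).
have fE N x : (f N x)%:E = mine (g x) N%:R%:E.
  rewrite fineK// ge0_fin_numE; last by rewrite le_min g0 lee_fin ler0n.
  by apply: (@le_lt_trans _ _ N%:R%:E); [rewrite ge_min lexx orbT|exact: ltry].
have fN N x : 0 <= f N x <= N%:R.
  by rewrite -!lee_fin fE le_min g0 lee_fin ler0n ge_min lexx orbT.
have Pf N : P (f N).
  by exists N%:R => x; have /andP[f0 fN'] := fN N x; rewrite ger0_norm.
have lf N : l (f N) <= M - a.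
  have : a <= l (cst M - f N).
    apply: (lC _ u) => //; last by rewrite upE.
      apply: Psub.1; first exact: bounded_funs_cst.
      exact: (subspaceN Psub (Pf N)).
    move=> x Kx; rewrite (_ : (cst M - f N) x = M - f N x)//.
    have : ((f N x)%:E <= M%:E - u x)%E by rewrite fE -gK// ge_min lexx.
    case: (u x) (uoo x) => [r| |]// _; last by rewrite leNye.
    by rewrite -EFinB !lee_fin; lra.
  rewrite llin.1//; [|exact: bounded_funs_cst|exact: (subspaceN Psub (Pf N))].
  rewrite (lN _ (Pf N)) (_ : cst M = M *: cst 1); first by rewrite llin.2// l1 mulr1; lra.
  by apply/funext => x; exact/esym/mulr1.
(* The superlevel set is empty for [t >= N], everything for [t < 0], and a sublevel set of [u] in
   between. *)
have of_ N t : open [set x | t < f N x].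
  have [Nt|tN] := leP N%:R t.
    rewrite (_ : [set _ | _] = set0); first exact: open0.
    rewrite -subset0 => x /=; rewrite ltNge => /negP; apply.
    by have /andP[_ h] := fN N x; exact: le_trans Nt.
  have [t0|t0] := ltP t 0.
    rewrite (_ : [set _ | _] = setT); first exact: openT.
    rewrite -subTset => x _ /=; apply: lt_le_trans t0 _.
    by have /andP[] := fN N x.
  rewrite (_ : [set _ | _] = [set x | (u x < (M - t)%:E)%E]).
    exact: usc_openP.
  rewrite predeqE => x /=.
  rewrite -lte_fin fE lt_min lte_fin tN andbT lt_max lte_fin (ltNge t) t0 orbF.
  case: (u x) (uoo x) => [r| |]// _; last by rewrite ltNyr ltry.
  by rewrite -EFinB !lte_fin ltrBrDl ltrBrDr addrC.
have intf N : (\int[nu]_(x in K) mine (g x) N%:R%:E <= (M - a)%:E)%E.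
  under eq_integral do rewrite -fE.
  by apply: le_trans (nul _ _ (fN N) (of_ N)) _; rewrite lee_fin.
have mg : measurable_fun (K : set (g_sigma_algebraType (@open T))) g.
  by apply: measurable_maxe => //; exact: emeasurable_funB.
have mgN N : measurable_fun (K : set (g_sigma_algebraType (@open T)))
    (fun x => mine (g x) N%:R%:E).
  exact: measurable_mine.
have gN0 N x : (0 <= mine (g x) N%:R%:E)%E by rewrite le_min g0 lee_fin ler0n.
have gnd x : {homo (fun N : nat => mine (g x) N%:R%:E) : N N' / (N <= N')%N >->
    (N <= N')%E}.
  by move=> N N' NN; apply: le_min2 => //; rewrite lee_fin ler_nat.
have limg x : limn (fun N : nat => mine (g x) N%:R%:E) = g x.
  have cv := ereal_nondecreasing_is_cvgn (gnd x).
  apply/eqP; rewrite eq_le; apply/andP; split.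
    by apply: lime_le => //; near=> N; rewrite ge_min lexx.
  (* Real lower bounds of [g x] pass to the limit, which also settles [g x = +oo]. *)
  have hb (b : R) : (b%:E <= g x)%E ->
      (b%:E <= limn (fun N : nat => mine (g x) N%:R%:E))%E.
    move=> bg; apply: lime_ge => //.
    by near=> N; rewrite le_min bg lee_fin; near: N; exact: nbhs_infty_ger.
  move: hb; case: (g x) (g0 x) => [r| |]// _ hb; first exact: hb.
  by rewrite leye_eq; apply/eqP/eqyP => b _; apply: hb; rewrite leey.
have intg : (\int[nu]_(x in K) g x <= (M - a)%:E)%E.
  have cv := @cvg_monotone_convergence _ _ _ nu _ mK _ mgN
    (fun N x _ => gN0 N x) (fun x _ => gnd x).
  rewrite (_ : (\int[nu]_(x in K) g x)%E =
      (\int[nu]_(x in K) limn (fun N : nat => mine (g x) N%:R%:E))%E).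
    rewrite -(cvg_lim _ cv)//; apply: lime_le; first by apply/cvg_ex; eexists; exact: cv.
    by near=> N; exact: intf.
  by apply: eq_integral => x _; rewrite limg.
have ig : nu.-integrable K g.
  apply/integrableP; split=> //.
  under eq_integral do rewrite gee0_abs//.
  by apply: le_lt_trans intg _; exact: ltry.
have iM : nu.-integrable K (EFin \o cst M).
  exact: finite_measure_integrable_cst.
(* On [K], [u = M - g] with [g] integrable, so the integral splits and the bound on [g] gives
   [u p <= \int u]. *)
rewrite (_ : (\int[nu]_(x in K) u x)%E = (\int[nu]_(x in K) (M%:E - g x))%E).
  rewrite integralB// integral_cst// [X in (_ * X)%E]nuK mule1.
  have := integrable_fin_num mK ig; move: intg.
  case: (\int[nu]_(x in K) g x)%E => [r| |]//.
  by rewrite -EFinB !lee_fin; lra.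
apply: eq_integral => x /set_mem Kx; rewrite gK//.
by case: (u x) (uoo x) => [r| |]// _; rewrite -!EFinB; congr EFin; lra.
Unshelve. all: by end_near. Qed.

End Edwards.

(** * The minimal hull in three-dimensional space *)

HB.instance Definition _ (R : realType) (m n : nat) :=
  PseudoMetric.on 'M[R]_(m, n).

Theorem corollary6p5 (R : realType) (K : set 'rV[R]_3) (hK : compact K)
    (p : 'rV[R]_3) :
  minimal_hull K p <->
  exists nu : probability (g_sigma_algebraType (@open 'rV[R]_3)) R,
    nu K = 1%E /\
    forall u : 'rV[R]_3 -> \bar R, MPsh setT u ->
      (u p <= \int[nu]_(x in K) u x)%E /\
      (\int[nu]_(x in K) u x <= sup_on K u)%E.
Proof.
(* The converse chains the two inequalities through the integral; the direct implication is the
   duality for the cone [MPsh setT]. *)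
split=> [pK|[nu [_ nuu]] u /nuu[]]; last exact: le_trans.
apply: (@jensen_measure R _ K p (MPsh setT)).
- exact: (@norm_hausdorff R).
- exact: hK.
- by move=> u v; exact: MPshD.
- by move=> k u; exact: MPshZ.
- by move=> b; exact: MPsh_cst.
- by move=> u [].
- by move=> u x [+ _ _]; apply.
- exact: pK.
Qed.
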